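(* The group $\mathbb{G}=\langle a,b,c,d\rangle\subset \mathrm{Aut}(\mathbf{T})$ has intermediate growth, i.e. its growth function $\gamma$ is both superpolynomial and subexponential: $\frac{\ln\gamma(n)}{\ln n}\to\infty$ and $\frac{\ln\gamma(n)}{n}\to 0$ as $n\to\infty$.
   Context: Let $\mathbf{T}$ be the infinite rooted binary tree whose vertices are the finite words over $\{0,1\}$; the root is the empty word, and the oriented edges go from $v$ to $v0$ and from $v$ to $v1$. $\mathrm{Aut}(\mathbf{T})$ is the group of bijections of the vertex set mapping edges into edges (they fix the root and preserve levels), with product $(\tau_1\cdot\tau_2)(v)=\tau_2(\tau_1(v))$ and identity $\mathtt{I}$. Let $a\in\mathrm{Aut}(\mathbf{T})$ fix the root and satisfy $a(0w)=1w$, $a(1w)=0w$ for all words $w$. For $\tau_0,\tau_1\in\mathrm{Aut}(\mathbf{T})$ let $\varphi(\tau_0,\tau_1)\in\mathrm{Aut}(\mathbf{T})$ be the automorphism fixing the root with $0w\mapsto 0\,\tau_0(w)$, $1w\mapsto 1\,\tau_1(w)$. Let $b,c,d\in\mathrm{Aut}(\mathbf{T})$ be the (unique) automorphisms with $b=\varphi(a,c)$, $c=\varphi(a,d)$, $d=\varphi(\mathtt{I},b)$, and let $\mathbb{G}=\langle a,b,c,d\rangle$. For a group $G$ with finite generating set $S$, $\ell_S(g)$ is the length of a shortest expression of $g$ as a product of elements of $S$ and their inverses, and the growth function is $\gamma(n)=\#\{g\in G:\ell_S(g)\le n\}$. Here $\gamma$ is the growth function with respect to any finite generating set; whether growth is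 intermediate does not depend on the choice. *)

(* Defs.v *)
From HB Require Import structures.
From mathcomp Require Import all_boot all_order all_algebra finmap.
From mathcomp Require Import all_classical all_reals all_analysis.

Set Implicit Arguments.
Unset Strict Implicit.
Unset Printing Implicit Defensive.

Import Order.TTheory GRing.Theory Num.Theory.
Import numFieldNormedType.Exports.

Local Open Scope classical_set_scope.

Section WordGrowth.
Context {G : groupType}.
Implicit Types (S : set G) (g : G).

Definition generated S : set G :=
  smallest [set H : set G | group_closed (mem H)] S.

Definition expressible S g (n : nat) : Prop :=
  exists w : seq G,
    [/\ size w = n, forall x, x \in w -> S x \/ S (x^-1)%g
      & (\prod_(x <- w) x)%g = g].

(* The value 0 for elements outside the subgroup generated by S is junk. *)
Definition word_length S g : nat :=
  if pselect (exists n, `[< expressible S g n >]) is left e then ex_minn e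
  else 0.

(* The ball is finite whenever S is; fset_set sends infinite sets to fset0. *)
Definition growth S (n : nat) : nat :=
  #|` fset_set [set g | generated S g /\ (word_length S g <= n)%N] |.

End WordGrowth.

Definition superpolynomial (R : realType) (gamma : nat -> nat) : Prop :=
  (ln (gamma n)%:R / ln n%:R : R)%R @[n --> \oo] --> +oo%R.

Definition subexponential (R : realType) (gamma : nat -> nat) : Prop :=
  (ln (gamma n)%:R / n%:R : R)%R @[n --> \oo] --> (0 : R)%R.

(* The letters 0 and 1 are false and true.  Words are read from the root
   downwards, so the children of v are rcons v false and rcons v true, while
   x :: w is the word xw. *)
Definition vertex := seq bool.

Definition edge (u v : vertex) : Prop := exists x : bool, v = rcons u x.

Record autT := AutT {
  aut_fun :> vertex -> vertex;
  aut_bij : bijective aut_fun;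
  aut_edge : forall u v, edge u v -> edge (aut_fun u) (aut_fun v) }.

HB.instance Definition _ := gen_eqMixin autT.
HB.instance Definition _ := gen_choiceMixin autT.

Lemma autP (s t : autT) : s =1 t -> s = t.
Proof.
case: s t => [f fb fe] [g gb ge] /= /funext fg; case: _ / fg gb ge => gb ge.
by congr AutT; exact: Prop_irrelevance.
Qed.

Lemma aut_nil (s : autT) : s [::] = [::].
Proof.
have [g gK Kg] := aut_bij s; move: (Kg [::]).
case/lastP: (g [::]) => // w x.
have [y ->] : edge (s w) (s (rcons w x)) by apply: aut_edge; exists x.
by case: (s w).
Qed.

Lemma aut_id_edge u v : edge u v -> edge (@id vertex u) (@id vertex v).
Proof. by []. Qed.

Definition aut_id : autT := AutT (Bijective (fun=> erefl) (fun=> erefl)) aut_id_edge.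

Lemma aut_comp_edge (s t : autT) u v :
  edge u v -> edge ((t \o s) u) ((t \o s) v).
Proof. by move=> uv; do 2!apply: aut_edge. Qed.

Definition aut_mul (s t : autT) : autT :=
  AutT (bij_comp (aut_bij t) (aut_bij s)) (@aut_comp_edge s t).

Lemma aut_inv_subproof (s : autT) :
  exists g : vertex -> vertex, cancel s g /\ cancel g s.
Proof. by have [g] := aut_bij s; exists g. Qed.

Definition aut_inv_fun (s : autT) : vertex -> vertex :=
  sval (cid (aut_inv_subproof s)).

Lemma aut_funK (s : autT) : cancel s (aut_inv_fun s).
Proof. by rewrite /aut_inv_fun; case: cid => g []. Qed.

Lemma aut_inv_funK (s : autT) : cancel (aut_inv_fun s) s.
Proof. by rewrite /aut_inv_fun; case: cid => g []. Qed.

Lemma aut_inv_edge (s : autT) u v :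
  edge u v -> edge (aut_inv_fun s u) (aut_inv_fun s v).
Proof.
case=> x ->; move: (aut_inv_funK s (rcons u x)).
case/lastP: (aut_inv_fun s (rcons u x)) => [|w y].
  by rewrite aut_nil; case: u.
have [z ->] : edge (s w) (s (rcons w y)) by apply: aut_edge; exists y.
by move=> /rcons_inj[<- _]; exists y; rewrite aut_funK.
Qed.

Definition aut_inv (s : autT) : autT :=
  AutT (Bijective (aut_inv_funK s) (aut_funK s)) (@aut_inv_edge s).

Lemma aut_mulA : associative aut_mul.
Proof. by move=> s t r; apply: autP. Qed.

Lemma aut_mul1 : left_id aut_id aut_mul.
Proof. by move=> s; apply: autP. Qed.

Lemma aut_mulr1 : right_id aut_id aut_mul.
Proof. by move=> s; apply: autP. Qed.

Lemma aut_mulV : left_inverse aut_id aut_inv aut_mul.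
Proof. by move=> s; apply: autP => v /=; rewrite aut_inv_funK. Qed.

Lemma aut_mulrV : right_inverse aut_id aut_inv aut_mul.
Proof. by move=> s; apply: autP => v /=; rewrite aut_funK. Qed.

HB.instance Definition _ :=
  isGroup.Build autT aut_mulA aut_mul1 aut_mulr1 aut_mulV aut_mulrV.

Lemma aut_mulE (s t : autT) v : (s * t)%g v = t (s v).
Proof. by []. Qed.

Lemma aut_oneE v : (1%g : autT) v = v.
Proof. by []. Qed.

Lemma edge_nil v : edge [::] v <-> exists x, v = [:: x].
Proof. by []. Qed.

Lemma edge_cons x y u v : edge (x :: u) (y :: v) <-> x = y /\ edge u v.
Proof.
split=> [[z /= [-> ->]]|[-> [z ->]]]; last by exists z.
by split=> //; exists z.
Qed.

Definition phi_fun (f0 f1 : vertex -> vertex) (v : vertex) : vertex :=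
  match v with
  | [::] => [::]
  | false :: w => false :: f0 w
  | true :: w => true :: f1 w
  end.

Lemma phi_bij (s t : autT) : bijective (phi_fun s t).
Proof.
by exists (phi_fun (aut_inv s) (aut_inv t)); case=> [|[] w] //=;
  rewrite ?aut_funK ?aut_inv_funK.
Qed.

Lemma phi_edge (s t : autT) u v :
  edge u v -> edge (phi_fun s t u) (phi_fun s t v).
Proof.
case: u => [|x u].
  by case/edge_nil=> -[] -> /=; rewrite aut_nil; apply/edge_nil; eexists.
case: v => [|y v]; first by case.
by case/edge_cons=> <- uv; case: x => /=; apply/edge_cons; split=> //;
  apply: aut_edge.
Qed.

Definition phi (s t : autT) : autT := AutT (phi_bij s t) (@phi_edge s t).

Definition a_fun (v : vertex) : vertex :=
  if v is x :: w then ~~ x :: w else [::].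

Lemma a_funK : involutive a_fun.
Proof. by case=> //= x w; rewrite negbK. Qed.

Lemma a_edge u v : edge u v -> edge (a_fun u) (a_fun v).
Proof. by case=> x ->; case: u => [|y u] /=; eexists. Qed.

Definition gen_a : autT := AutT (inv_bij a_funK) a_edge.

(* The recursion b = phi(a, c), c = phi(a, d), d = phi(1, b). *)
Fixpoint b_fun (v : vertex) : vertex :=
  match v with
  | [::] => [::]
  | false :: w => false :: a_fun w
  | true :: w => true :: c_fun w
  end
with c_fun (v : vertex) : vertex :=
  match v with
  | [::] => [::]
  | false :: w => false :: a_fun w
  | true :: w => true :: d_fun w
  end
with d_fun (v : vertex) : vertex :=
  match v with
  | [::] => [::]
  | false :: w => false :: w
  | true :: w => true :: b_fun w
  end.

Lemma bcd_funK v : [/\ b_fun (b_fun v) = v, c_fun (c_fun v) = v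
                     & d_fun (d_fun v) = v].
Proof.
by elim: v => [|[] w [bw cw dw]] //=; rewrite ?bw ?cw ?dw ?a_funK.
Qed.

Lemma b_funK : involutive b_fun. Proof. by move=> v; case: (bcd_funK v). Qed.
Lemma c_funK : involutive c_fun. Proof. by move=> v; case: (bcd_funK v). Qed.
Lemma d_funK : involutive d_fun. Proof. by move=> v; case: (bcd_funK v). Qed.

Lemma bcd_edge u v : edge u v -> [/\ edge (b_fun u) (b_fun v),
  edge (c_fun u) (c_fun v) & edge (d_fun u) (d_fun v)].
Proof.
elim: u v => [|x u IH] v.
  by case/edge_nil=> -[] -> /=; split; apply/edge_nil; eexists.
case: v => [|y v]; first by case.
case/edge_cons=> <- uv; have [bE cE dE] := IH v uv; have aE := a_edge uv.
by case: x => /=; split; apply/edge_cons.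
Qed.

Lemma b_edge u v : edge u v -> edge (b_fun u) (b_fun v).
Proof. by case/bcd_edge. Qed.
Lemma c_edge u v : edge u v -> edge (c_fun u) (c_fun v).
Proof. by case/bcd_edge. Qed.
Lemma d_edge u v : edge u v -> edge (d_fun u) (d_fun v).
Proof. by case/bcd_edge. Qed.

Definition gen_b : autT := AutT (inv_bij b_funK) b_edge.
Definition gen_c : autT := AutT (inv_bij c_funK) c_edge.
Definition gen_d : autT := AutT (inv_bij d_funK) d_edge.

Lemma gen_bE : gen_b = phi gen_a gen_c.
Proof. by apply: autP => -[|[] w]. Qed.
Lemma gen_cE : gen_c = phi gen_a gen_d.
Proof. by apply: autP => -[|[] w]. Qed.
Lemma gen_dE : gen_d = phi 1%g gen_b.
Proof. by apply: autP => -[|[] w]. Qed.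

Lemma gen_bcd_unique (b c d : autT) :
  b = phi gen_a c -> c = phi gen_a d -> d = phi 1%g b ->
  [/\ b = gen_b, c = gen_c & d = gen_d].
Proof.
move=> bE cE dE.
have E v : [/\ b v = gen_b v, c v = gen_c v & d v = gen_d v].
  elim: v => [|x w [bw cw dw]]; first by rewrite !aut_nil.
  by split; [rewrite bE gen_bE|rewrite cE gen_cE|rewrite dE gen_dE];
    case: x => //=; rewrite ?bw ?cw ?dw.
by split; apply: autP => v; case: (E v).
Qed.

Definition grigorchuk_group : set autT :=
  generated [set gen_a; gen_b; gen_c; gen_d].

(* Main.v *)
Require Import Defs.
From mathcomp Require Import all_boot all_order all_algebra finmap.
From mathcomp Require Import all_classical all_reals all_analysis.
From mathcomp Require Import zify ring lra.

Set Implicit Arguments.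
Unset Strict Implicit.
Unset Printing Implicit Defensive.

Import Order.TTheory GRing.Theory Num.Theory.
Import numFieldNormedType.Exports.

(** The group is self-similar: an element that fixes the two subtrees below
    the root is [phi g0 g1] with [g0] and [g1] again in the group, and any
    other element is such an element times [a].  Both halves of the theorem
    compare lengths across this decomposition.

    Superpolynomial growth.  Every [g] in the group is the right coordinate of
    some [phi x g] in the group, where [x] lies in the dihedral group of order
    8 generated by [a] and [d] and the length is multiplied by at most 3
    ([lift_right]).  Multiplying [phi x g] by a conjugate [phi h y] of
    [phi y h] shows that pairs of elements of length [n] are represented, up
    to 64 choices, by single elements of length [6 n + 2]
    ([ball_has_square]).  Hence [gamma n ^ 2 <= 64 gamma (8 n)] for [n > 0].
    The group is infinite because it is transitive on each level of the tree
    ([gens_transitive]), so some ball has 128 elements, and iterating gives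
    [gamma (8 ^ (r + k)) >= 2 ^ 2 ^ k] ([ball_has_double_exp]), which outgrows
    every polynomial.

    Subexponential growth.  The letters [a], [b], [c], [d] receive the weights
    3, 3, 2, 1.  Since [1, b, c, d] form a Klein four-group, each element is an
    alternating product of letters [a] and elements of this subgroup, and for
    the weighted length the coordinates satisfy
    [|g0| + |g1| <= 5/6 (|g| + 3)] ([weight_ball_split]).  A weighted ball of
    radius [n] is therefore covered by pairs from balls whose radii add up to
    [5/6 n + O(1)], so a bound [C exp (mu n)] on its size improves to
    [C' exp (11/12 mu n)] ([weight_growth_le_contract]).  Iterating, every
    positive rate is reached.

    Both bounds pass to an arbitrary finite generating set because lengths
    change by at most a constant factor ([ball_change]). *)

Local Open Scope classical_set_scope.

(** * Balls in finitely generated groups *)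

Section Balls.
Context {G : groupType}.
Implicit Types (S T : set G) (g h : G).

Definition ball S n g : Prop := exists2 k, (k <= n)%N & expressible S g k.

Lemma ball_le S m n g : (m <= n)%N -> ball S m g -> ball S n g.
Proof. by move=> mn [k km Sgk]; exists k => //; exact: leq_trans mn. Qed.

Lemma ball1 S n : ball S n 1%g.
Proof. by exists 0%N => //; exists [::]; rewrite big_nil. Qed.

Lemma ball_gen S g : S g -> ball S 1 g.
Proof.
move=> Sg; exists 1%N => //; exists [:: g]; rewrite big_seq1; split=> // x.
by rewrite inE => /eqP->; left.
Qed.

Lemma ballM S m n g h : ball S m g -> ball S n h -> ball S (m + n) (g * h)%g.
Proof.
move=> [k km [v [vk vS <-]]] [l ln [w [wl wS <-]]].
exists (k + l)%N; first exact: leq_add.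
exists (v ++ w); rewrite size_cat vk wl big_cat; split=> // x.
by rewrite mem_cat => /orP[/vS|/wS].
Qed.

Lemma ballV S n g : ball S n g -> ball S n (g^-1)%g.
Proof.
move=> [k kn [w [wk wS <-]]]; exists k => //.
elim: w k {kn} wk wS => [k|x w IH [|k]] //=.
  by move=> <- _; exists [::]; rewrite !big_nil invg1.
move=> [wk] xwS; rewrite big_cons invgM.
have [y yw|v [vk vS <-]] := IH k wk; first by apply: xwS; rewrite inE yw orbT.
exists (rcons v (x^-1)%g); split; first by rewrite size_rcons vk.
  move=> y; rewrite mem_rcons inE => /predU1P[->|/vS//].
  by rewrite invgK; case: (xwS x (mem_head _ _)); [right|left].
by rewrite -cats1 big_cat big_seq1.
Qed.

Lemma ball_ind S (P : nat -> G -> Prop) :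
    P 0%N 1%g ->
    (forall n x g, S x \/ S (x^-1)%g -> P n g -> P n.+1 (x * g)%g) ->
    (forall n g, P n g -> P n.+1 g) ->
  forall n g, ball S n g -> P n g.
Proof.
move=> P0 PS Ple n g [k /subnK<- [w [wk wS <-]]].
elim: (n - k)%N => [|j IH]; last exact: Ple.
rewrite add0n; elim: w k wk wS => [k <- _|x w IH [|k]] //=.
  by rewrite big_nil.
move=> [wk] xwS; rewrite big_cons; apply: PS; first exact: xwS (mem_head _ _).
by apply: IH => // y yw; apply: xwS; rewrite inE yw orbT.
Qed.

(** A generating set whose letters have length at most [K] over [T] changes
    lengths by a factor at most [K]; this is why the type of growth does not
    depend on the generators. *)
Lemma ball_change S T K : (forall x, S x -> ball T K x) ->
  forall n g, ball S n g -> ball T (K * n) g.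
Proof.
move=> ST; apply: ball_ind => [|n x g Sx Tg|n g]; first exact: ball1.
  rewrite mulnS; apply: ballM => //; case: Sx => /ST// /ballV.
  by rewrite invgK.
by apply: ball_le; rewrite leq_mul2l leqnSn orbT.
Qed.

Lemma generatedP S g : generated S g <-> exists n, ball S n g.
Proof.
split=> [|[n]].
- apply: (@smallest_sub _ _ _ [set g | exists n, ball S n g]); last first.
    by move=> x Sx; exists 1%N; exact: ball_gen.
  split=> [|x y /set_mem[m xm] /set_mem[n yn]]; apply/mem_set.
    by exists 0%N; exact: ball1.
  by exists (m + n)%N; apply: ballM => //; exact: ballV.
- move: n g; apply: (ball_ind (P := fun=> generated S)) => //.
    by move=> H [[/set_mem]].
  move=> _ x h Sx Hh H [Hc SH].
  have xH : x \in mem H.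
    case: Sx => [/SH/mem_set//|/SH/mem_set/(group_closedV Hc)].
    by rewrite invgK.
  have hH : h \in mem H by apply/mem_set; exact: Hh.
  exact: set_mem (group_closedM Hc xH hH).
Qed.

Lemma growthE S n : growth S n = #|` fset_set (ball S n)|.
Proof.
rewrite /growth; congr #|` fset_set _|; apply/seteqP; split=> g /=.
  case=> /generatedP[m [k _ Sgk]]; rewrite /word_length.
  case: pselect => [e|[]]; last by exists k; apply/asboolP.
  by case: ex_minnP => j /asboolP Sgj _ jn; exists j.
move=> Sg; split; first by apply/generatedP; exists n.
case: Sg => k kn Sgk; rewrite /word_length; case: pselect => // e.
by case: ex_minnP => j _ /(_ k (asboolT Sgk)) /leq_trans; exact.
Qed.

Lemma finite_cover (A : set G) (l : seq G) :
  (forall g, A g -> g \in l) -> finite_set A.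
Proof. by move=> Al; apply: sub_finite_set (finite_seq l) => g /Al. Qed.

Lemma growth_le S n (l : seq G) :
  (forall g, ball S n g -> g \in l) -> (growth S n <= size l)%N.
Proof.
move=> Sl; rewrite growthE; apply: uniq_leq_size => [|g]; first exact: fset_uniq.
by rewrite in_fset_set ?inE; [exact: Sl|exact: finite_cover Sl].
Qed.

Lemma growth_ge S n (l : seq G) : finite_set (ball S n) -> uniq l ->
  (forall g, g \in l -> ball S n g) -> (size l <= growth S n)%N.
Proof.
move=> fS lu lS; rewrite growthE; apply: uniq_leq_size => // g /lS Sg.
by rewrite in_fset_set // inE.
Qed.

End Balls.

(** * Relations between the generators *)

Local Notation gens := [set gen_a; gen_b; gen_c; gen_d].

Lemma phiM (s t s' t' : autT) : (phi s t * phi s' t')%g = phi (s * s')%g (t * t')%g.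
Proof. by apply: autP => -[|[] w]. Qed.

Lemma phi11 : phi 1%g 1%g = 1%g.
Proof. by apply: autP => -[|[] w]. Qed.

Lemma phi_inj (s t s' t' : autT) : phi s t = phi s' t' -> s = s' /\ t = t'.
Proof.
move=> E; have Ev v := congr1 (fun f : autT => f v) E.
by split; apply: autP => v; [case: (Ev (false :: v))|case: (Ev (true :: v))].
Qed.

Lemma aa : (gen_a * gen_a = 1)%g. Proof. by apply: autP; exact: a_funK. Qed.
Lemma bb : (gen_b * gen_b = 1)%g. Proof. by apply: autP; exact: b_funK. Qed.
Lemma cc : (gen_c * gen_c = 1)%g. Proof. by apply: autP; exact: c_funK. Qed.
Lemma dd : (gen_d * gen_d = 1)%g. Proof. by apply: autP; exact: d_funK. Qed.

Lemma aphi (s t : autT) : (gen_a * phi s t = phi t s * gen_a)%g.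
Proof. by apply: autP => -[|[] w]. Qed.

Lemma aphia (s t : autT) : (gen_a * phi s t * gen_a = phi t s)%g.
Proof. by rewrite aphi -mulgA aa mulg1. Qed.

(** The products [bc = d], [cd = b], [db = c] are read off the recursion: each
    of them passes to the next one on the subtree below 1. *)
Lemma bcd_mul v :
  [/\ c_fun (b_fun v) = d_fun v, d_fun (c_fun v) = b_fun v
    & b_fun (d_fun v) = c_fun v].
Proof.
by elim: v => [|[] w [IHb IHc IHd]] //=; rewrite ?IHb ?IHc ?IHd ?a_funK.
Qed.

Lemma bc : (gen_b * gen_c = gen_d)%g.
Proof. by apply: autP => v; case: (bcd_mul v). Qed.
Lemma cd : (gen_c * gen_d = gen_b)%g.
Proof. by apply: autP => v; case: (bcd_mul v). Qed.
Lemma db : (gen_d * gen_b = gen_c)%g.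
Proof. by apply: autP => v; case: (bcd_mul v). Qed.

Lemma gensV x : gens (x^-1)%g -> gens x.
Proof.
have inv (y : autT) : (y * y = 1)%g -> (y^-1 = y)%g by move=> /mulg1_eq.
move=> [[[|]|]|] xE; rewrite -(invgK x) xE inv ?aa ?bb ?cc ?dd //.
- by left; left; left.
- by left; left; right.
- by left; right.
- by right.
Qed.

Lemma ball_a : ball gens 1 gen_a. Proof. by apply: ball_gen; left; left; left. Qed.
Lemma ball_b : ball gens 1 gen_b. Proof. by apply: ball_gen; left; left; right. Qed.
Lemma ball_c : ball gens 1 gen_c. Proof. by apply: ball_gen; left; right. Qed.
Lemma ball_d : ball gens 1 gen_d. Proof. by apply: ball_gen; right. Qed.

Lemma ball_gens_ind (P : nat -> autT -> Prop) :
    P 0%N 1%g ->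
    (forall n x g, gens x -> P n g -> P n.+1 (x * g)%g) ->
    (forall n g, P n g -> P n.+1 g) ->
  forall n g, ball gens n g -> P n g.
Proof.
by move=> P0 PS Ple; apply: ball_ind => // n x g [|/gensV]; exact: PS.
Qed.

(** * Squaring of the growth *)

(** The dihedral group generated by [a] and [d], of order 8. *)
Definition dihedral_ad : seq autT :=
  [:: 1; gen_a; gen_d; gen_a * gen_d; gen_d * gen_a; gen_a * (gen_d * gen_a);
      gen_d * (gen_a * gen_d); gen_a * (gen_d * (gen_a * gen_d))]%g.

(** Both sides are [phi b b], because [ada = phi b 1] and [d = phi 1 b]
    commute. *)
Lemma adad : (gen_d * (gen_a * (gen_d * gen_a)) =
              gen_a * (gen_d * (gen_a * gen_d)))%g.
Proof.
have ada : (gen_a * (gen_d * gen_a) = phi gen_b 1)%g.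
  by rewrite gen_dE mulgA aphia.
have -> : (gen_a * (gen_d * (gen_a * gen_d)) =
           gen_a * (gen_d * gen_a) * gen_d)%g by rewrite !mulgA.
by rewrite ada gen_dE !phiM !mulg1 !mul1g.
Qed.

Lemma dihedral_ad_a x : x \in dihedral_ad -> (gen_a * x)%g \in dihedral_ad.
Proof.
have aK (y : autT) : (gen_a * (gen_a * y) = y)%g by rewrite mulgA aa mul1g.
by rewrite !inE => /or4P[/eqP->|/eqP->|/eqP->|/or4P[/eqP->|/eqP->|/eqP->|
  /orP[/eqP->|/eqP->]]]; rewrite ?mulg1 ?aa ?aK ?eqxx ?orbT.
Qed.

Lemma dihedral_ad_d x : x \in dihedral_ad -> (gen_d * x)%g \in dihedral_ad.
Proof.
have dK (y : autT) : (gen_d * (gen_d * y) = y)%g by rewrite mulgA dd mul1g.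
by rewrite !inE => /or4P[/eqP->|/eqP->|/eqP->|/or4P[/eqP->|/eqP->|/eqP->|
  /orP[/eqP->|/eqP->]]];
  rewrite -?adad ?mulg1 ?dd ?dK ?eqxx ?orbT // adad eqxx ?orbT.
Qed.

(** The substitution [a -> aca, b -> d, c -> b, d -> c] turns a word for [g]
    into a word for some [phi x g], since [aca = phi d a], [d = phi 1 b],
    [b = phi a c] and [c = phi a d]; the first coordinate is a product of
    letters [a] and [d]. *)
Lemma lift_right n g : ball gens n g ->
  exists2 x, x \in dihedral_ad & ball gens (3 * n) (phi x g).
Proof.
move: n g; apply: ball_gens_ind => [|n y g yS [x xD xg]|n g [x xD xg]].
- by exists 1%g; [rewrite mem_head|rewrite phi11; exact: ball1].
- case: yS => [[[|]|]|] ->; rewrite mulnS.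
  + exists (gen_d * x)%g; first exact: dihedral_ad_d.
    rewrite -phiM -aphia -gen_cE; apply: ballM xg.
    exact: (ballM (ballM ball_a ball_c) ball_a).
  + exists (1 * x)%g; first by rewrite mul1g.
    by rewrite -phiM -gen_dE; apply: ballM xg; exact: ball_le ball_d.
  + exists (gen_a * x)%g; first exact: dihedral_ad_a.
    by rewrite -phiM -gen_bE; apply: ballM xg; exact: ball_le ball_b.
  + exists (gen_a * x)%g; first exact: dihedral_ad_a.
    by rewrite -phiM -gen_cE; apply: ballM xg; exact: ball_le ball_c.
- by exists x => //; apply: ball_le xg; rewrite leq_mul2l leqnSn.
Qed.

Definition ball_has (N n : nat) : Prop :=
  exists l : seq autT, [/\ uniq l, (N <= size l)%N
    & forall g, g \in l -> ball gens n g].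

(** For [g], [h] in the ball of radius [n], the product of [phi x g] and
    [phi h y = a (phi y h) a] is [phi (x h) (g y)], which determines [g] and
    [h] up to the at most 64 possibilities for [(x, y)]. *)
Lemma ball_has_square N n : ball_has N n ->
  exists2 M, (N * N <= 64 * M)%N & ball_has M (6 * n + 2).
Proof.
move=> [l [lu Nl lS]].
have /choice[f fP] g : exists x, g \in l ->
    x \in dihedral_ad /\ ball gens (3 * n) (phi x g).
  case: (boolP (g \in l)) => [/lS/lift_right[x xD xg]|_]; first by exists x.
  by exists 1%g.
pose F (p : autT * autT) := phi (f p.1 * p.2)%g (p.1 * f p.2)%g.
pose l2 := [seq (g, h) | g <- l, h <- l].
have l2P p : p \in l2 -> p.1 \in l /\ p.2 \in l.
  by case/allpairsP => -[g h] /= [gl hl ->].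
exists (size (undup [seq F p | p <- l2])); last first.
  exists (undup [seq F p | p <- l2]); split=> // [|g]; first exact: undup_uniq.
  rewrite mem_undup => /mapP[p /l2P[/fP[_ gS] /fP[_ hS]] ->].
  rewrite /F -phiM -(aphia (f p.2)).
  have -> : (6 * n + 2 = 3 * n + ((1 + 3 * n) + 1))%N by lia.
  by apply: ballM => //; apply: ballM ball_a; exact: ballM ball_a _.
pose code p := (F p, (f p.1, f p.2)).
have code_inj : injective code.
  move=> [g h] [g' h'] /eqP; rewrite !xpair_eqE.
  move=> /and3P[/eqP/phi_inj[/= + +] /eqP fE /eqP gE].
  by rewrite fE gE => /mulgI-> /mulIg->.
apply: (@leq_trans (size [seq code p | p <- l2])).
  by rewrite size_map size_allpairs leq_mul.
have -> : (64 * size (undup [seq F p | p <- l2]) =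
  size [seq (u, v) | u <- undup [seq F p | p <- l2],
    v <- [seq (x, y) | x <- dihedral_ad, y <- dihedral_ad]])%N.
  by rewrite !size_allpairs mulnC.
apply: uniq_leq_size => [|_ /mapP[p pl2 ->]].
  by rewrite map_inj_uniq // allpairs_uniq // => -[? ?] [].
have [/fP[gD _] /fP[hD _]] := l2P _ pl2.
by apply: allpairs_f; [rewrite mem_undup map_f|exact: allpairs_f].
Qed.

Lemma gens_transitive (u v : vertex) : size u = size v ->
  exists2 g : autT, g u = v & exists n, ball gens n g.
Proof.
elim: u v => [|x u IH] [|y v] //= => [_|[/IH[g gu [n gS]]]].
  by exists 1%g => //; exists 0%N; exact: ball1.
have [s _ sg] := lift_right gS.
have flip z : ball gens 1 (if z then 1 else gen_a)%g.
  by case: z; [exact: ball1|exact: ball_a].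
exists ((if x then 1 else gen_a) * phi s g * (if y then 1 else gen_a))%g.
  by case: x; case: y; rewrite /= gu.
by eexists; apply: ballM (flip y); exact: ballM (flip x) sg.
Qed.

(** The orbit of a vertex of level [k] has [2 ^ k] elements. *)
Lemma ball_has_pow2 k : exists n, ball_has (2 ^ k) n.
Proof.
pose o := nseq k false.
have /choice[f fP] (t : k.-tuple bool) : exists g : autT,
    g o = t /\ exists n, ball gens n g.
  have [|g gt gS] := @gens_transitive o t; first by rewrite size_nseq size_tuple.
  by exists g.
have /choice[r rP] t : exists n, ball gens n (f t) by case: (fP t).
exists (\max_t r t)%N, [seq f t | t <- enum {: k.-tuple bool}]; split.
- rewrite map_inj_uniq ?enum_uniq // => s t fst; apply: val_inj => /=.
  by rewrite -(fP s).1 -(fP t).1 fst.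
- by rewrite size_map -cardE card_tuple card_bool.
- by move=> _ /mapP[t _ ->]; apply: ball_le (rP t); exact: leq_bigmax.
Qed.

Lemma ball_has_le N M n m : (M <= N)%N -> (n <= m)%N ->
  ball_has N n -> ball_has M m.
Proof.
move=> MN nm [l [lu Nl lS]]; exists l; split=> // [|g /lS].
  exact: leq_trans Nl.
exact: ball_le.
Qed.

(** Measured in units of 64 elements, the size is squared exactly when the
    radius is multiplied by 8; the start [128 = 64 * 2] makes it grow. *)
Lemma ball_has_double_exp : exists r, forall k,
  ball_has (64 * 2 ^ 2 ^ k) (8 ^ (r + k)).
Proof.
have [n n_ball] := ball_has_pow2 7; exists n; elim=> [|k IH].
  by rewrite addn0; apply: ball_has_le n_ball => //; exact/ltnW/ltn_expl.
have [M NM hM] := ball_has_square IH; apply: (ball_has_le _ _ hM).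
  rewrite -(leq_pmul2l (isT : 0 < 64)%N); apply: leq_trans NM.
  by rewrite [(2 ^ k.+1)%N]expnS mul2n -addnn expnD; lia.
by rewrite (addnS n) expnS; have := expn_gt0 8 (n + k); lia.
Qed.

(** * Contraction of a weighted length *)

(** The subgroup [{1, b, c, d}], as a type on which one can compute. *)
Inductive klein := K1 | Kb | Kc | Kd.

Definition kval x : autT :=
  match x with K1 => 1%g | Kb => gen_b | Kc => gen_c | Kd => gen_d end.

Definition kmul x y :=
  match x, y with
  | K1, z | z, K1 => z
  | Kb, Kb | Kc, Kc | Kd, Kd => K1
  | Kb, Kc | Kc, Kb => Kd
  | Kc, Kd | Kd, Kc => Kb
  | Kd, Kb | Kb, Kd => Kc
  end.

(** Subadditivity forces [b <= c + d]; subject to it, these weights make the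
    two coordinates together lighter than the element by a factor 5/6, up to
    a constant. *)
Definition kweight x : nat :=
  match x with K1 => 0 | Kb => 3 | Kc => 2 | Kd => 1 end.

(** The left coordinate of [kval x] is a power of [a]; the boolean is the
    exponent. *)
Definition kleft x : bool := match x with Kb | Kc => true | _ => false end.

Definition kright x :=
  match x with K1 => K1 | Kb => Kc | Kc => Kd | Kd => Kb end.

Definition a_pow (e : bool) : autT := if e then gen_a else 1%g.

Lemma kvalM x y : kval (kmul x y) = (kval x * kval y)%g.
Proof.
have cb : (gen_c * gen_b = gen_d)%g by rewrite -cd mulgA cc mul1g.
have dc : (gen_d * gen_c = gen_b)%g by rewrite -db mulgA dd mul1g.
have bd : (gen_b * gen_d = gen_c)%g by rewrite -bc mulgA bb mul1g.
by case: x; case: y;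
  rewrite /= ?mul1g ?mulg1 ?bb ?cc ?dd ?bc ?cd ?db ?cb ?dc ?bd.
Qed.

Lemma kweightM x y : (kweight (kmul x y) <= kweight x + kweight y)%N.
Proof. by case: x; case: y. Qed.

Lemma kvalE x : kval x = phi (a_pow (kleft x)) (kval (kright x)).
Proof. by case: x; rewrite /= ?phi11 -?gen_bE -?gen_cE -?gen_dE. Qed.

(** The alternating product [x a y1 a y2 ... a yk]. *)
Fixpoint alternate x (s : seq klein) : autT :=
  if s is y :: s' then (kval x * gen_a * alternate y s')%g else kval x.

Fixpoint weight x (s : seq klein) : nat :=
  kweight x + (if s is y :: s' then 3 + weight y s' else 0).

Definition weight_ball n g : Prop :=
  exists x s, (weight x s <= n)%N /\ alternate x s = g.

Lemma weight_ball1 : weight_ball 0 1%g.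
Proof. by exists K1, [::]. Qed.

Lemma weight_ball_le m n g : (m <= n)%N -> weight_ball m g -> weight_ball n g.
Proof.
by move=> mn [x [s [ws <-]]]; exists x, s; split=> //; exact: leq_trans mn.
Qed.

Lemma weight_ball_a n g : weight_ball n g -> weight_ball (3 + n) (gen_a * g)%g.
Proof. by move=> [x [s [ws <-]]]; exists K1, (x :: s); rewrite /= mul1g. Qed.

Lemma weight_ball_a_pow (e : bool) n g :
  weight_ball n g -> weight_ball (3 * e + n) (a_pow e * g)%g.
Proof. by case: e => [/weight_ball_a//|]; rewrite mul1g. Qed.

Lemma weight_ball_klein y n g :
  weight_ball n g -> weight_ball (kweight y + n) (kval y * g)%g.
Proof.
move=> [x [s [ws <-]]]; exists (kmul y x), s; split.
  by have := kweightM y x; case: s ws => [|z s] /=; lia.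
by case: s {ws} => [|z s] /=; rewrite kvalM ?mulgA.
Qed.

Lemma ball_weight n g : ball gens n g -> weight_ball (3 * n) g.
Proof.
move: n g; apply: ball_gens_ind => [|n x g|n g]; first exact: weight_ball1.
  rewrite mulnS; case=> [[[|]|]|] ->.
  - exact: weight_ball_a.
  - exact: (@weight_ball_klein Kb).
  - by move=> /(@weight_ball_klein Kc); apply: weight_ball_le; rewrite leq_add2r.
  - by move=> /(@weight_ball_klein Kd); apply: weight_ball_le; rewrite leq_add2r.
by apply: weight_ball_le; rewrite leq_mul2l leqnSn.
Qed.

(** Every letter of the alternating product contributes to both coordinates.
    The weights are such that the two contributions of a letter [x], together,
    weigh at most 5/6 of [x] and a letter [a] next to it:
    [3 + 2 <= 5/6 (3 + 3)] for [b], [3 + 1 <= 5/6 (3 + 2)] for [c] and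
    [0 + 3 <= 5/6 (3 + 1)] for [d]. *)
Lemma weight_ball_split n g : weight_ball n g ->
  exists m0 m1 g0 g1 e, [/\ (6 * (m0 + m1) <= 5 * (n + 3))%N,
    weight_ball m0 g0, weight_ball m1 g1 & g = (phi g0 g1 * a_pow e)%g].
Proof.
move=> [x [s [ws <-]]].
suff [m0 [m1 [g0 [g1 [e [m01 ? ? ?]]]]]] : exists m0 m1 g0 g1 e,
    [/\ (6 * (m0 + m1) <= 5 * (weight x s + 3))%N, weight_ball m0 g0,
      weight_ball m1 g1 & alternate x s = (phi g0 g1 * a_pow e)%g].
  by exists m0, m1, g0, g1, e; split=> //; apply: leq_trans m01 _; lia.
have kcontract z : (6 * (3 * kleft z + kweight (kright z)) <= 5 * (kweight z + 3))%N.
  by case: z.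
elim: s x {n ws} => [|y s IH] x.
  exists (3 * kleft x + 0)%N, (kweight (kright x) + 0)%N.
  exists (a_pow (kleft x) * 1)%g, (kval (kright x) * 1)%g, false.
  split; last by rewrite !mulg1 -kvalE.
  - by have := kcontract x; rewrite /=; lia.
  - exact/weight_ball_a_pow/weight_ball1.
  - exact/weight_ball_klein/weight_ball1.
have [m0 [m1 [g0 [g1 [e [m01 g0m g1m gE]]]]]] := IH y.
(* Moving phi past a letter a exchanges the coordinates. *)
exists (3 * kleft x + m1)%N, (kweight (kright x) + m0)%N.
exists (a_pow (kleft x) * g1)%g, (kval (kright x) * g0)%g, (~~ e).
split.
- by have := kcontract x; rewrite /=; lia.
- exact: weight_ball_a_pow.
- exact: weight_ball_klein.
rewrite /= gE -phiM -kvalE -!mulgA (mulgA gen_a) aphi -mulgA.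
by case: e {gE}; rewrite /= ?aa ?mulg1.
Qed.

Lemma weight_ball_cover n : exists2 l : seq autT, (size l <= 4 * 5 ^ n)%N
  & forall g, weight_ball n g -> g \in l.
Proof.
suff [l ln lP] : exists2 l : seq autT, (size l <= 4 * 5 ^ n)%N &
    forall x s, (size s <= n)%N -> alternate x s \in l.
  exists l => // g [x [s [ws <-]]]; apply: lP; apply: leq_trans ws.
  by elim: s x => [|y s IH] x //=; have := IH y; lia.
pose V := [seq kval x | x <- [:: K1; Kb; Kc; Kd]].
have VP x : kval x \in V by case: x; rewrite !inE eqxx ?orbT.
elim: n => [|n [l ln lP]]; first by exists V => // x [|y s] //=.
exists (l ++ [seq (x * gen_a * g)%g | x <- V, g <- l]).
  by rewrite size_cat size_allpairs expnS; rewrite /=; lia.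
move=> x [|y s] sn; rewrite mem_cat; first by apply/orP; left; exact: lP.
apply/orP; right; apply: (allpairs_f (fun x g : autT => x * gen_a * g)%g) => //.
exact: lP.
Qed.

Local Open Scope ring_scope.

Definition weight_growth_le (R : realType) (mu : R) : Prop :=
  exists C : R, forall n, exists2 l : seq autT,
    (size l)%:R <= C * expR (mu * n%:R) & forall g, weight_ball n g -> g \in l.

Lemma weight_growth_le_ln5 (R : realType) : weight_growth_le (ln 5 : R).
Proof.
exists 4 => n; have [l ln lP] := weight_ball_cover n; exists l => //.
rewrite expRM_natr lnK ?posrE //.
by rewrite -natrX -natrM ler_nat.
Qed.

(** If balls of weight [n] have at most [C exp (mu n)] elements, then a
    ball of weight [n] is covered by the pairs with total weight at most
    [m = 5/6 (n + 3)], and there are at most [2 (m + 1) C^2 exp (mu m)] of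
    those: the exponential rate falls to [5/6 mu], up to the polynomial
    factor, which is absorbed by replacing [5/6] by [11/12]. *)
Lemma weight_growth_le_contract (R : realType) (mu : R) : 0 < mu ->
  weight_growth_le mu -> weight_growth_le (11 / 12 * mu).
Proof.
move=> mu0 [C CP].
have /choice[L LP] n : exists l : seq autT,
    (size l)%:R <= C * expR (mu * n%:R) /\ forall g, weight_ball n g -> g \in l.
  by have [l] := CP n; exists l.
pose pairs m := [seq (phi p.1 p.2 * a_pow e)%g |
  p <- flatten [seq [seq (g, h) | g <- L i, h <- L (m - i)%N] | i <- iota 0 m.+1],
  e <- [:: false; true]].
have size_pairs m :
    (size (pairs m))%:R <= 2 * m.+1%:R * C ^+ 2 * expR (mu * m%:R) :> R.
  rewrite size_allpairs size_flatten /shape -map_comp sumnE big_map.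
  have -> : iota 0 m.+1 = index_iota 0 m.+1 by rewrite /index_iota subn0.
  rewrite mulnC natrM natr_sum -!mulrA ler_pM2l //.
  rewrite -[m.+1 in leRHS]subn0 mulr_natl -sumr_const_nat.
  rewrite big_nat_cond [leRHS]big_nat_cond; apply: ler_sum => i.
  rewrite andbT => /andP[_ im]; rewrite /= size_allpairs natrM.
  rewrite -[m in leRHS](@subnKC i) // natrD mulrDr expRD mulrA mulrACA.
  by apply: ler_pM; rewrite ?ler0n ?(LP _).1.
exists (20 / mu * C ^+ 2 * expR (77 / 20 * mu)) => n.
pose m := (5 * (n + 3) %/ 6)%N; exists (pairs m); last first.
  move=> g /weight_ball_split[i [j [g0 [g1 [e [ij g0i g1j ->]]]]]].
  have im : (i + j <= m)%N by rewrite /m leq_divRL // mulnC.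
  apply: (allpairs_f (fun (p : autT * autT) e => phi p.1 p.2 * a_pow e)%g
    (x := (g0, g1))); last by case: e.
  apply/flattenP; exists [seq (g, h) | g <- L i, h <- L (m - i)%N].
    by apply/mapP; exists i => //; rewrite mem_iota; lia.
  apply: allpairs_f; first exact: (LP i).2.
  by apply: (LP _).2; apply: weight_ball_le g1j; lia.
apply: le_trans (size_pairs m) _.
have mn : m.+1%:R <= 5 / 6 * n%:R + 7 / 2 :> R.
  have : (6 * m <= 5 * (n + 3))%N by rewrite mulnC leq_trunc_div.
  by rewrite -(ler_nat R) !natrM natrD -(natr1 m); lra.
have mexp : m.+1%:R <= 10 / mu * expR (mu / 10 * m.+1%:R).
  rewrite mulrAC ler_pdivlMr // -ler_pdivrMl // mulrC mulrAC.
  apply: le_trans (expR_ge1Dx _); rewrite mulrAC; lra.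
apply: (@le_trans _ _ (20 / mu * C ^+ 2 *
    (expR (mu / 10 * m.+1%:R) * expR (mu * m%:R)))).
  have -> : 20 / mu * C ^+ 2 * (expR (mu / 10 * m.+1%:R) * expR (mu * m%:R)) =
      2 * C ^+ 2 * expR (mu * m%:R) * (10 / mu * expR (mu / 10 * m.+1%:R)).
    by field; exact: lt0r_neq0.
  rewrite [leLHS](_ : _ = 2 * C ^+ 2 * expR (mu * m%:R) * m.+1%:R); last by ring.
  apply: ler_wpM2l => //; apply: mulr_ge0; last exact: expR_ge0.
  by rewrite mulr_ge0 ?sqr_ge0.
rewrite -[leRHS]mulrA; apply: ler_wpM2l.
  by rewrite mulr_ge0 ?sqr_ge0 // divr_ge0 // ltW.
rewrite -!expRD ler_expR.
have -> : m%:R = m.+1%:R - 1 :> R by rewrite -natr1 addrK.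
have := ler_wpM2l (ltW mu0) mn; nra.
Qed.

Lemma weight_growth_le_small (R : realType) (e : R) : 0 < e ->
  exists2 mu, mu <= e & weight_growth_le mu.
Proof.
move=> e0; pose q : R := 11 / 12; have q0 : 0 < q by rewrite /q; lra.
have ln5 : 0 < ln 5 :> R by apply: ln_gt0; rewrite ltr1n.
have rate k : weight_growth_le (q ^+ k * ln 5).
  elim: k => [|k IH]; first by rewrite expr0 mul1r; exact: weight_growth_le_ln5.
  rewrite exprS -mulrA; apply: weight_growth_le_contract => //.
  by rewrite mulr_gt0 ?exprn_gt0.
have q1 : `|q| < 1 by rewrite gtr0_norm // /q; lra.
have /cvgrPdist_le/(_ e e0)[k _ /(_ k (leqnn k))] := cvg_geometric (ln 5) q1.
rewrite sub0r normrN /= => small; exists (q ^+ k * ln 5) => //.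
by rewrite mulrC; apply: le_trans small; exact: ler_norm.
Qed.

(** * From bounds on the growth function to its type *)

Lemma linear_le_exp c k : (2 * c <= k -> c * k <= 2 ^ k)%N.
Proof.
move=> /subnK<-; elim: (k - 2 * c)%N => [|j IH].
  rewrite add0n; case: c {k} => // c; have := ltn_expl c (isT : 1 < 2)%N.
  rewrite (mul2n c.+1) -addnn expnD !expnS; nia.
have := ltn_expl (j + 2 * c) (isT : 1 < 2)%N.
by rewrite addSn mulnS expnS; lia.
Qed.

Lemma superpolynomial_double_exp (R : realType) (gamma : nat -> nat) q :
    (forall k n, (8 ^ (q + k) <= n)%N -> (2 ^ 2 ^ k <= gamma n)%N) ->
  superpolynomial R gamma.
Proof.
move=> gammaP; apply/cvgryPge => A; pose B := (Num.trunc A).+1.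
have AB : A <= B%:R by apply/ltW/truncnS_gt.
pose c := (3 * B * (q + 2))%N; pose k0 := (2 * c).+1.
near=> n.
have n8 : (8 ^ (q + k0) <= n)%N by near: n; exact: nbhs_infty_ge.
have n1 : (1 < n)%N by apply: leq_trans n8; rewrite (ltn_exp2l 0) //; lia.
have [k k0k [kn nk]] : exists2 k, (k0 <= k)%N &
    (8 ^ (q + k) <= n)%N /\ (n < 8 ^ (q + k).+1)%N.
  have qt : (q + k0 <= trunc_log 8 n)%N by exact: trunc_log_max.
  exists (trunc_log 8 n - q)%N; first by lia.
  rewrite subnKC; last by lia.
  by apply/andP; apply: trunc_log_bounds => //; lia.
have ln2 : 0 < ln 2 :> R by apply: ln_gt0; rewrite ltr1n.
have lnn : 0 < ln n%:R :> R by apply: ln_gt0; rewrite ltr1n.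
rewrite ler_pdivlMr //.
apply: (@le_trans _ _ (B%:R * ((3 * (q + k).+1)%:R * ln 2))).
  apply: le_trans (ler_wpM2r (ltW lnn) AB) _; apply: ler_wpM2l => //.
  rewrite mulr_natl -lnXn // ler_ln ?posrE ?exprn_gt0 ?ltr0n //; last by lia.
  by rewrite -natrX ler_nat expnM; exact: ltnW.
apply: (@le_trans _ _ ((2 ^ k)%:R * ln 2)).
  rewrite mulrA ler_pM2r // -natrM ler_nat.
  have := @linear_le_exp c k; rewrite /c /k0 in k0k *; nia.
have gn := gammaP _ _ kn.
rewrite mulr_natl -lnXn // ler_ln ?posrE ?exprn_gt0 ?ltr0n -?natrX ?ler_nat //.
by apply: leq_trans gn; rewrite expn_gt0.
Unshelve. all: by end_near. Qed.

Lemma subexponential_small_rate (R : realType) (gamma : nat -> nat) :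
    (forall e : R, 0 < e ->
      exists C, forall n, (gamma n)%:R <= C * expR (e * n%:R)) ->
  subexponential R gamma.
Proof.
move=> gammaP; apply/cvgrPdist_le => e e0.
have e2 : 0 < e / 2 by lra.
have [C CP] := gammaP _ e2; pose D := Num.max C 1.
have D1 : 1 <= D by rewrite le_max lexx orbT.
near=> n.
have n0 : 0 < n%:R :> R by near: n; exact: nbhs_infty_gtr.
have nD : ln D <= e / 2 * n%:R.
  by rewrite mulrC -ler_pdivrMr //; near: n; exact: nbhs_infty_ger.
have lnD : 0 <= ln D by exact: ln_ge0.
rewrite sub0r normrN ler_norml; apply/andP; split.
  apply: (@le_trans _ _ 0); first by rewrite oppr_le0 ltW.
  apply: divr_ge0; last exact: ltW.
  by case: (gamma n) => [|k]; [rewrite ln0|apply: ln_ge0; rewrite ler1n].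
rewrite ler_pdivrMr //; case: (posnP (gamma n)) => [->|gn].
  by rewrite ln0 // mulr_ge0 // ltW.
apply: (@le_trans _ _ (ln (D * expR (e / 2 * n%:R)))).
  rewrite ler_ln ?posrE ?ltr0n //.
    by apply: le_trans (CP n) _; rewrite ler_wpM2r ?expR_ge0 // le_max lexx.
  by rewrite mulr_gt0 ?expR_gt0 //; lra.
by rewrite lnM ?posrE ?expR_gt0 ?expRK //; lra.
Unshelve. all: by end_near. Qed.

(** * The growth of the group *)

Lemma ball_uniform (S T : set autT) : finite_set S ->
  (forall x, S x -> generated T x) -> exists K, forall x, S x -> ball T K x.
Proof.
move=> /finite_seqP[s ->] sT.
have /choice[r rP] x : exists n, x \in s -> ball T n x.
  case: (boolP (x \in s)) => [/sT/generatedP[n xn]|_]; first by exists n.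
  by exists 0%N.
exists (\max_(x <- s) r x)%N => x xs; apply: ball_le (rP x xs).
exact: leq_bigmax_seq.
Qed.

Theorem theorem4p1 (R : realType) (S : set autT) (finS : finite_set S)
    (genS : generated S = grigorchuk_group) :
  superpolynomial R (growth S) /\ subexponential R (growth S).
Proof.
have [K SK] : exists K, forall x, S x -> ball gens K x.
  apply: ball_uniform => // x Sx.
  by rewrite -/grigorchuk_group -genS; apply/generatedP; exists 1%N; exact: ball_gen.
have [J gensJ] : exists J, forall x, gens x -> ball S J x.
  apply: ball_uniform => [|x xgens]; first by rewrite !finite_setU.
  by rewrite genS; apply/generatedP; exists 1%N; exact: ball_gen.
have toW n g : ball S n g -> weight_ball (3 * (K * n)) g.
  by move=> /(ball_change SK)/ball_weight.
have finB n : finite_set (ball S n).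
  have [l _ lP] := weight_ball_cover (3 * (K * n)).
  by apply: (@finite_cover _ _ l) => g /toW/lP.
split.
  have [r rP] := ball_has_double_exp.
  apply: (@superpolynomial_double_exp _ _ (J + r)) => k n n8.
  have [l [lu ls lP]] := rP k.
  apply: (@leq_trans (size l)); first by apply: leq_trans ls; rewrite leq_pmull.
  apply: growth_ge => // g /lP/(ball_change gensJ); apply: ball_le.
  apply: leq_trans n8; rewrite -addnA (expnD 8 J) leq_mul2r.
  by apply/orP; right; exact/ltnW/ltn_expl.
apply: subexponential_small_rate => e e0.
have e3K : 0 < e / (3 * K).+1%:R by rewrite divr_gt0 // ltr0n.
have [mu mue [C CP]] := weight_growth_le_small e3K.
exists C => n; have [l ls lP] := CP (3 * (K * n))%N.
have C0 : 0 <= C.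
  have := le_trans (ler0n R (size l)) ls.
  by rewrite pmulr_lge0 // expR_gt0.
apply: (@le_trans _ _ (size l)%:R).
  by rewrite ler_nat; apply: growth_le => g /toW/lP.
apply: le_trans ls _; apply: ler_wpM2l => //; rewrite ler_expR mulnA natrM mulrA.
apply: ler_wpM2r => //; rewrite ler_pdivlMr ?ltr0n // in mue.
have K0 : 0 <= (3 * K)%:R :> R by [].
by move: mue; rewrite -(natr1 (3 * K)); case: (lerP 0 mu) => mu0; nra.
Qed.
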